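(* Let $r=n$ be odd. The center of the quasi-Laurent polynomial algebra generated by the $n^2$ quantum minors $\chi_{\alpha,j}\in\mathcal D_{q^2}(M(n,n))$ is generated by $$Z:=\prod_{\gamma=1}^{n}\chi_{\gamma,n}^{(-1)^\gamma}\prod_{k=1}^{n-1}\chi_{n,k}^{(-1)^k}$$ and its inverse.
   Context: Let $n,r$ be positive integers (here $r=n$) and $q\in\mathbb C\setminus\{0\}$ not a root of unity. $\mathcal O_q(M(n,r))$ is the $\mathbb C$-algebra generated by $Z_{\alpha j}$ ($1\le\alpha\le n$, $1\le j\le r$) with relations: $Z_{\alpha j}Z_{\alpha k}=qZ_{\alpha k}Z_{\alpha j}$ ($j<k$); $Z_{\alpha j}Z_{\beta j}=qZ_{\beta j}Z_{\alpha j}$ ($\alpha<\beta$); $Z_{\alpha j}Z_{\beta l}=Z_{\beta l}Z_{\alpha j}$ ($\alpha>\beta,\ j<l$); $Z_{\alpha j}Z_{\beta l}=Z_{\beta l}Z_{\alpha j}+(q-q^{-1})Z_{\alpha l}Z_{\beta j}$ ($\alpha<\beta,\ j<l$). Adjoin mutually commuting invertible $R_\alpha,C_j$ with $R_\alpha Z_{\beta i}=q^{\delta_{\alpha\beta}}Z_{\beta i}R_\alpha$, $C_jZ_{\alpha i}=q^{\delta_{ij}}Z_{\alpha i}C_j$. With $M_{\alpha j}=R_{\alpha+1}\cdots R_nC_{j+1}^{-1}\cdots C_r^{-1}$, the Dipper–Donkin algebra $\mathcal D_{q^2}(M(n,r))$ is the subalgebra generated by $W_{\alpha j}=Z_{\alpha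 j}M_{\alpha j}$. For $\boldsymbol\alpha=\{\alpha_1<\dots<\alpha_m\}$, $\mathbf j=\{j_1<\dots<j_m\}$ let $\xi^{\boldsymbol\alpha}_{\mathbf j}=\sum_{\sigma\in S_m}(-q)^{\ell(\sigma)}Z_{\alpha_1,j_{\sigma(1)}}\cdots Z_{\alpha_m,j_{\sigma(m)}}$ and let the quantum minor $\chi^{\boldsymbol\alpha}_{\mathbf j}\in\mathcal D_{q^2}(M(n,r))$ be $\xi^{\boldsymbol\alpha}_{\mathbf j}M_{\alpha_1j_1}\cdots M_{\alpha_mj_m}$ times a suitable power of $q$ (irrelevant here). Put $\chi_{\alpha,j}=\chi^{\{\alpha-j+1,\dots,\alpha\}}_{\{1,\dots,j\}}$ if $\alpha\ge j$ and $\chi_{\alpha,j}=\chi^{\{1,\dots,\alpha\}}_{\{j-\alpha+1,\dots,j\}}$ if $\alpha<j$. These $nr$ elements satisfy $\chi_{\alpha,j}\chi_{\beta,k}=q^{\Lambda_{\alpha j,\beta k}}\chi_{\beta,k}\chi_{\alpha,j}$ with $\Lambda=\mathbb T^t(2H_D)\mathbb T$. Here $H_D$ is the $nr\times nr$ matrix of $n\times n$ blocks of size $r\times r$ with diagonal blocks $0$, blocks $M_r$ above and $N_r$ below the diagonal, where $N_r$ has all entries on and above the diagonal $-1$ and zeros below, $M_r=-N_r^t$; and $\mathbb T$ is block upper triangular with $(\alpha,\beta)$ block $T^{\beta-\alpha}$ for $\alpha\le\beta$, $T=\sum_{i=1}^{r-1}E_{i,i+1}$. The quasi-Laurent polynomial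 algebra generated by the $\chi_{\alpha,j}$ is the algebra generated by the $\chi_{\alpha,j}^{\pm1}$ subject to these $q$-commutation relations. The order of factors in a monomial only affects it by a power of $q$. *)

(* Defs.v *)
From HB Require Import structures.
From mathcomp Require Import all_boot all_order all_algebra.
From mathcomp Require Export complex.
From mathcomp Require Import ring.
From mathcomp Require Import boolp classical_sets.
From mathcomp Require Export reals.

Set Implicit Arguments.
Unset Strict Implicit.
Unset Printing Implicit Defensive.

Import GRing.Theory.

Local Open Scope ring_scope.
Local Open Scope quotient_scope.

(** * Unital associative algebras presented by generators and relations

    The algebra presented by generators [G] and relations [rel] over [K] is
    the quotient of the type of formal algebra expressions in [G] by the least
    congruence that contains [rel] and the axioms of unital associative
    [K]-algebras. *)

Section Presentation.
Variables (K : fieldType) (G : Type).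

Inductive expr : Type :=
| Gen of G
| Zero
| One
| Opp of expr
| Add of expr & expr
| Mul of expr & expr
| Scale of K & expr.

HB.instance Definition _ := gen_eqMixin expr.
HB.instance Definition _ := gen_choiceMixin expr.

Variable rel : expr -> expr -> Prop.

Inductive alg_congr : expr -> expr -> Prop :=
| c_rel x y : rel x y -> alg_congr x y
| c_refl x : alg_congr x x
| c_sym x y : alg_congr x y -> alg_congr y x
| c_trans x y z : alg_congr x y -> alg_congr y z -> alg_congr x z
| c_opp x x' : alg_congr x x' -> alg_congr (Opp x) (Opp x')
| c_add x x' y y' : alg_congr x x' -> alg_congr y y' -> alg_congr (Add x y) (Add x' y')
| c_mul x x' y y' : alg_congr x x' -> alg_congr y y' -> alg_congr (Mul x y) (Mul x' y')
| c_scale a x x' : alg_congr x x' -> alg_congr (Scale a x) (Scale a x')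
| c_addA x y z : alg_congr (Add x (Add y z)) (Add (Add x y) z)
| c_addC x y : alg_congr (Add x y) (Add y x)
| c_add0 x : alg_congr (Add Zero x) x
| c_addN x : alg_congr (Add (Opp x) x) Zero
| c_mulA x y z : alg_congr (Mul x (Mul y z)) (Mul (Mul x y) z)
| c_mul1l x : alg_congr (Mul One x) x
| c_mul1r x : alg_congr (Mul x One) x
| c_mulDl x y z : alg_congr (Mul (Add x y) z) (Add (Mul x z) (Mul y z))
| c_mulDr x y z : alg_congr (Mul x (Add y z)) (Add (Mul x y) (Mul x z))
| c_scaleA a b x : alg_congr (Scale a (Scale b x)) (Scale (a * b) x)
| c_scale1 x : alg_congr (Scale 1 x) x
| c_scaleDr a x y : alg_congr (Scale a (Add x y)) (Add (Scale a x) (Scale a y))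
| c_scaleDl a b x : alg_congr (Scale (a + b) x) (Add (Scale a x) (Scale b x))
| c_scaleMl a x y : alg_congr (Scale a (Mul x y)) (Mul (Scale a x) y)
| c_scaleMr a x y : alg_congr (Scale a (Mul x y)) (Mul x (Scale a y)).

Definition congrb (x y : expr) : bool := `[< alg_congr x y >].

Lemma congrb_equiv : equiv_class_of congrb.
Proof.
split=> [x|x y|y x z /asboolP xy /asboolP yz]; rewrite /congrb.
- exact/asboolP/c_refl.
- by apply/asboolP/asboolP; apply: c_sym.
- exact/asboolP/(c_trans xy).
Qed.

Definition congr_equiv : equiv_rel expr := EquivRelPack congrb_equiv.

Definition presented : Type := {eq_quot congr_equiv}.
HB.instance Definition _ := Choice.on presented.
HB.instance Definition _ := EqQuotient.on presented.

Definition pi_presented (x : expr) : presented := \pi_presented x.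

Lemma pi_presentedP x y : pi_presented x = pi_presented y <-> alg_congr x y.
Proof.
split=> [/eqmodP/asboolP //|xy]; exact/eqmodP/asboolP.
Qed.

Lemma reprP x : alg_congr (repr (pi_presented x)) x.
Proof. by apply/pi_presentedP; rewrite /pi_presented reprK. Qed.

Lemma presentedW (P : presented -> Prop) :
  (forall x, P (pi_presented x)) -> forall u, P u.
Proof. by move=> Ppi u; rewrite -[u]reprK; apply: Ppi. Qed.

Definition p_opp (u : presented) := pi_presented (Opp (repr u)).
Definition p_add (u v : presented) := pi_presented (Add (repr u) (repr v)).
Definition p_mul (u v : presented) := pi_presented (Mul (repr u) (repr v)).
Definition p_scale a (u : presented) := pi_presented (Scale a (repr u)).

Lemma p_oppE x : p_opp (pi_presented x) = pi_presented (Opp x).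
Proof. exact/pi_presentedP/c_opp/reprP. Qed.

Lemma p_addE x y :
  p_add (pi_presented x) (pi_presented y) = pi_presented (Add x y).
Proof. by apply/pi_presentedP/c_add; apply: reprP. Qed.

Lemma p_mulE x y :
  p_mul (pi_presented x) (pi_presented y) = pi_presented (Mul x y).
Proof. by apply/pi_presentedP/c_mul; apply: reprP. Qed.

Lemma p_scaleE a x : p_scale a (pi_presented x) = pi_presented (Scale a x).
Proof. exact/pi_presentedP/c_scale/reprP. Qed.

Let pE := (p_oppE, p_addE, p_mulE, p_scaleE).

Let p_addA : associative p_add.
Proof.
elim/presentedW=> x; elim/presentedW=> y; elim/presentedW=> z.
by rewrite !pE; apply/pi_presentedP/c_addA.
Qed.

Let p_addC : commutative p_add.
Proof.
elim/presentedW=> x; elim/presentedW=> y.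
by rewrite !pE; apply/pi_presentedP/c_addC.
Qed.

Let p_add0 : left_id (pi_presented Zero) p_add.
Proof. by elim/presentedW=> x; rewrite !pE; apply/pi_presentedP/c_add0. Qed.

Let p_addN : left_inverse (pi_presented Zero) p_opp p_add.
Proof. by elim/presentedW=> x; rewrite !pE; apply/pi_presentedP/c_addN. Qed.

HB.instance Definition _ :=
  GRing.isZmodule.Build presented p_addA p_addC p_add0 p_addN.

Let p_mulA : associative p_mul.
Proof.
elim/presentedW=> x; elim/presentedW=> y; elim/presentedW=> z.
by rewrite !pE; apply/pi_presentedP/c_mulA.
Qed.

Let p_mul1l : left_id (pi_presented One) p_mul.
Proof. by elim/presentedW=> x; rewrite !pE; apply/pi_presentedP/c_mul1l. Qed.

Let p_mul1r : right_id (pi_presented One) p_mul.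
Proof. by elim/presentedW=> x; rewrite !pE; apply/pi_presentedP/c_mul1r. Qed.

Let p_mulDl : left_distributive p_mul +%R.
Proof.
elim/presentedW=> x; elim/presentedW=> y; elim/presentedW=> z.
by rewrite /GRing.add/= !pE; apply/pi_presentedP/c_mulDl.
Qed.

Let p_mulDr : right_distributive p_mul +%R.
Proof.
elim/presentedW=> x; elim/presentedW=> y; elim/presentedW=> z.
by rewrite /GRing.add/= !pE; apply/pi_presentedP/c_mulDr.
Qed.

HB.instance Definition _ := GRing.Zmodule_isPzRing.Build presented
  p_mulA p_mul1l p_mul1r p_mulDl p_mulDr.

Let p_scaleA a b u : p_scale a (p_scale b u) = p_scale (a * b) u.
Proof.
by elim/presentedW: u => x; rewrite !pE; apply/pi_presentedP/c_scaleA.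
Qed.

Let p_scale1 : left_id 1 p_scale.
Proof. by elim/presentedW=> x; rewrite !pE; apply/pi_presentedP/c_scale1. Qed.

Let p_scaleDr : right_distributive p_scale +%R.
Proof.
move=> a; elim/presentedW=> x; elim/presentedW=> y.
by rewrite /GRing.add/= !pE; apply/pi_presentedP/c_scaleDr.
Qed.

Let p_scaleDl u : {morph p_scale^~ u : a b / a + b}.
Proof.
elim/presentedW: u => x a b.
by rewrite [RHS]/GRing.add/= !pE; apply/pi_presentedP/c_scaleDl.
Qed.

HB.instance Definition _ := GRing.Zmodule_isLmodule.Build K presented
  p_scaleA p_scale1 p_scaleDr p_scaleDl.

Lemma presented_scalerAl (a : K) (u v : presented) :
  a *: (u * v) = (a *: u) * v.
Proof.
elim/presentedW: u => x; elim/presentedW: v => y.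
by rewrite /GRing.scale/GRing.mul/= !pE; apply/pi_presentedP/c_scaleMl.
Qed.

Lemma presented_scalerAr (a : K) (u v : presented) :
  a *: (u * v) = u * (a *: v).
Proof.
elim/presentedW: u => x; elim/presentedW: v => y.
by rewrite /GRing.scale/GRing.mul/= !pE; apply/pi_presentedP/c_scaleMr.
Qed.

Lemma pi0 : pi_presented Zero = 0. Proof. by []. Qed.

Lemma pi1 : pi_presented One = 1. Proof. by []. Qed.

Lemma piN x : pi_presented (Opp x) = - pi_presented x.
Proof. by rewrite -p_oppE. Qed.

Lemma piD x y : pi_presented (Add x y) = pi_presented x + pi_presented y.
Proof. by rewrite -p_addE. Qed.

Lemma piM x y : pi_presented (Mul x y) = pi_presented x * pi_presented y.
Proof. by rewrite -p_mulE. Qed.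

Lemma piZ a x : pi_presented (Scale a x) = a *: pi_presented x.
Proof. by rewrite -p_scaleE. Qed.

End Presentation.

Arguments Zero {K G}.
Arguments One {K G}.
Arguments Gen {K G} _.

(** * The exponent matrix [Lambda]

    Rows and columns of these [nr x nr] matrices are indexed by
    [tagnat.Rank a j], the [j]-th position of the [a]-th block. All indices
    are shifted by one: the ordinals [a : 'I_n], [j : 'I_r] stand for the row
    [a.+1] and the column [j.+1]. *)

Section Lambda.
Variables n r : nat.

Definition Nmx : 'M[int]_r := \matrix_(i, j) (if (i <= j)%N then -1 else 0).

Definition Mmx : 'M[int]_r := - Nmx^T.

Definition HD : 'M[int]_(\sum_(a < n) r) :=
  \mxblock_(a < n, b < n)
    (if (a < b)%N then Mmx else if (b < a)%N then Nmx else 0).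

Definition shiftmx : 'M[int]_r := \matrix_(i, j) (i.+1 == j)%:R.

Definition TT : 'M[int]_(\sum_(a < n) r) :=
  \mxblock_(a < n, b < n) (if (a <= b)%N then shiftmx ^+ (b - a)%N else 0).

Definition Lambda : 'M[int]_(\sum_(a < n) r) := TT^T *m (HD *+ 2) *m TT.

Lemma HD_skew : HD^T = - HD.
Proof.
apply/matrixP=> s t; rewrite !mxE.
set a := tagnat.sig1 s; set b := tagnat.sig1 t.
case: ltngtP => ab; rewrite ?mxE ?opprK ?oppr0 //.
Qed.

Definition halfLambda : 'M[int]_(\sum_(a < n) r) := TT^T *m HD *m TT.

Lemma LambdaE : Lambda = halfLambda *+ 2.
Proof. by rewrite /Lambda mulr2n mulmxDr mulmxDl -mulr2n. Qed.

Lemma halfLambda_skew s t : halfLambda t s = - halfLambda s t.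
Proof.
have : halfLambda^T = - halfLambda.
  by rewrite /halfLambda !trmx_mul trmxK HD_skew mulNmx mulmxN mulmxA.
by move/matrixP/(_ s t); rewrite !mxE.
Qed.

End Lambda.

(** * The quasi-Laurent polynomial algebra of the quantum minors

    The quantum minors [chi_(a, j)] of the Dipper-Donkin algebra [q]-commute
    with exponent matrix [Lambda]. The quasi-Laurent polynomial algebra is the
    abstract algebra on symbols [chi_(a, j)^(+-1)] with these relations; [Chi]
    stands for a minor and [ChiV] for its formal inverse. *)

Inductive ql_gen (n r : nat) : Type :=
| Chi of 'I_(\sum_(a < n) r)
| ChiV of 'I_(\sum_(a < n) r).

Section QuasiLaurent.
Variables (K : fieldType) (q : K) (q_neq0 : q != 0) (n r : nat).

Local Notation idx := 'I_(\sum_(a < n) r).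
Local Notation ex := (expr K (ql_gen n r)).

Inductive ql_rel : ex -> ex -> Prop :=
| ql_mulXV s : ql_rel (Mul (Gen (Chi s)) (Gen (ChiV s))) One
| ql_mulVX s : ql_rel (Mul (Gen (ChiV s)) (Gen (Chi s))) One
| ql_comm s t : ql_rel (Mul (Gen (Chi s)) (Gen (Chi t)))
    (Scale (q ^ Lambda n r s t) (Mul (Gen (Chi t)) (Gen (Chi s)))).

(* The argument [q_neq0] is not used by the carrier; it makes the canonical
   structure of a nontrivial ring below available. *)
Definition quasi_laurent : Type := let _ := q_neq0 in presented ql_rel.

HB.instance Definition _ := GRing.PzRing.on quasi_laurent.
HB.instance Definition _ := GRing.Lmodule.on quasi_laurent.

(* Nontriviality: the algebra acts on the functions on the lattice of
   exponents. *)

Local Notation lat := 'rV[int]_(\sum_(a < n) r).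

Let c (s : idx) (m : lat) : int := - (m *m halfLambda n r) 0 s.
Let e (s : idx) : lat := delta_mx 0 s.

Let cD s m m' : c s (m + m') = c s m + c s m'.
Proof. by rewrite /c mulmxDl mxE opprD. Qed.

Let cN s m : c s (- m) = - c s m.
Proof. by rewrite /c mulNmx mxE. Qed.

Let ce s t : c t (e s) = - halfLambda n r s t.
Proof. by rewrite /c /e -rowE mxE. Qed.

Fixpoint ql_act (x : ex) (f : lat -> K) : lat -> K :=
  match x with
  | Gen (Chi s) => fun m => q ^ c s m * f (m - e s)
  | Gen (ChiV s) => fun m => q ^ (- c s (m + e s)) * f (m + e s)
  | Zero => fun=> 0
  | One => f
  | Opp x => fun m => - ql_act x f m
  | Add x y => fun m => ql_act x f m + ql_act y f m
  | Mul x y => ql_act x (ql_act y f)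
  | Scale a x => fun m => a * ql_act x f m
  end.

Lemma ql_act_lin x a f g :
  ql_act x (fun m => a * f m + g m) =
  (fun m => a * ql_act x f m + ql_act x g m).
Proof.
elim: x f g => [[s|s]|||x IHx|x IHx y IHy|x IHx y IHy|b x IHx] f g /=;
  apply/funext => m //.
- by rewrite mulrDr mulrCA.
- by rewrite mulrDr mulrCA.
- by rewrite mulr0 addr0.
- by rewrite IHx mulrN opprD.
- by rewrite IHx IHy mulrDr addrACA.
- by rewrite IHy IHx.
- by rewrite IHx mulrDr mulrCA.
Qed.

Lemma ql_actD x f g :
  ql_act x (fun m => f m + g m) = (fun m => ql_act x f m + ql_act x g m).
Proof.
have -> : (fun m => f m + g m) = (fun m => 1 * f m + g m).
  by apply/funext => m; rewrite mul1r.
by rewrite ql_act_lin; apply/funext => m; rewrite mul1r.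
Qed.

Lemma ql_act0 x : ql_act x (fun=> 0) = (fun=> 0).
Proof.
have := ql_act_lin x (-1) (fun=> 0) (fun=> 0).
have -> : (fun=> -1 * 0 + 0) = (fun=> 0) :> (lat -> K).
  by apply/funext => m; rewrite mulr0 addr0.
by move=> ->; apply/funext => m; rewrite mulN1r addNr.
Qed.

Lemma ql_actZ x a f :
  ql_act x (fun m => a * f m) = (fun m => a * ql_act x f m).
Proof.
have -> : (fun m => a * f m) = (fun m => a * f m + 0).
  by apply/funext => m; rewrite addr0.
by rewrite ql_act_lin ql_act0; apply/funext => m; rewrite addr0.
Qed.

Lemma ql_act_congr x y : alg_congr ql_rel x y -> ql_act x = ql_act y.
Proof.
elim=> {x y} /=; try by move=> *; apply/funext => f; apply/funext => m /=;
  rewrite ?(add0r, addNr, addrA, mulrA, mul1r, mulrDr, mulrDl, ql_actD, ql_actZ).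
- move=> x y [s|s|s t] /=; apply/funext => f; apply/funext => m.
  + by rewrite subrK mulrA -expfzDr// subrr expr0z mul1r.
  + by rewrite addrK mulrA -expfzDr// addNr expr0z mul1r.
  + rewrite !mulrA -!expfzDr// [m - _ - _]addrAC; congr (q ^ _ * _).
    rewrite LambdaE mulr2n mxE !cD !cN !ce (halfLambda_skew s t) !opprK.
    by ring.
- by move=> x y _ ->.
- by move=> x y z _ -> _ ->.
- by move=> x x' _ E; apply/funext => f; rewrite E.
- by move=> x x' y y' _ E _ E'; apply/funext => f; rewrite E E'.
- by move=> x x' y y' _ E _ E'; apply/funext => f; rewrite E E'.
- by move=> a x x' _ E; apply/funext => f; rewrite E.
- by move=> x y; apply/funext => f; apply/funext => m /=; rewrite addrC.
Qed.

Lemma ql_oner_neq0 : (1 : quasi_laurent) != 0.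
Proof.
apply/eqP => /pi_presentedP /ql_act_congr.
move=> /(congr1 (fun F => F (fun=> 1) 0)) /= /eqP.
by rewrite oner_eq0.
Qed.

HB.instance Definition _ :=
  GRing.PzSemiRing_isNonZero.Build quasi_laurent ql_oner_neq0.
HB.instance Definition _ := GRing.Lmodule_isLalgebra.Build K quasi_laurent
  (@presented_scalerAl K (ql_gen n r) ql_rel).
HB.instance Definition _ := GRing.Lalgebra_isAlgebra.Build K quasi_laurent
  (@presented_scalerAr K (ql_gen n r) ql_rel).

Let has_inv (u v : quasi_laurent) := v * u = 1 /\ u * v = 1.
Let ql_unit : pred quasi_laurent := fun u => `[< exists v, has_inv u v >].
Let ql_inv (u : quasi_laurent) : quasi_laurent :=
  if pselect (exists v, has_inv u v) is left uV then projT1 (cid uV) else u.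

Let ql_invP u : u \in ql_unit -> has_inv u (ql_inv u).
Proof.
move=> /asboolP uV; rewrite /ql_inv; case: pselect => // {}uV.
exact: projT2 (cid uV).
Qed.

Let ql_mulVr : {in ql_unit, left_inverse 1 ql_inv *%R}.
Proof. by move=> u /ql_invP[]. Qed.

Let ql_divrr : {in ql_unit, right_inverse 1 ql_inv *%R}.
Proof. by move=> u /ql_invP[]. Qed.

Let ql_unitrP u v : v * u = 1 /\ u * v = 1 -> ql_unit u.
Proof. by move=> uv; apply/asboolP; exists v. Qed.

Let ql_invr_out : {in [predC ql_unit], ql_inv =1 id}.
Proof.
move=> u /negP uV; rewrite /ql_inv; case: pselect => // uV'.
by case: uV; apply/asboolP.
Qed.

HB.instance Definition _ := GRing.NzRing_hasMulInverse.Build quasi_laurent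
  ql_mulVr ql_divrr ql_unitrP ql_invr_out.

Definition chi (a : 'I_n) (j : 'I_r) : quasi_laurent :=
  pi_presented ql_rel (Gen (Chi (tagnat.Rank a j))).

Definition chiV (a : 'I_n) (j : 'I_r) : quasi_laurent :=
  pi_presented ql_rel (Gen (ChiV (tagnat.Rank a j))).

Lemma chi_mulV a j : chi a j * chiV a j = 1.
Proof. by rewrite -[LHS]piM; apply/pi_presentedP/c_rel/ql_mulXV. Qed.

Lemma chi_mulVl a j : chiV a j * chi a j = 1.
Proof. by rewrite -[LHS]piM; apply/pi_presentedP/c_rel/ql_mulVX. Qed.

Lemma chi_unit a j : chi a j \is a GRing.unit.
Proof. by apply/unitrP; exists (chiV a j); rewrite chi_mulV chi_mulVl. Qed.

Lemma chiVE a j : chiV a j = (chi a j)^-1.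
Proof.
by apply: (mulrI (chi_unit a j)); rewrite chi_mulV divrr// chi_unit.
Qed.

Lemma chi_comm a j b k : chi a j * chi b k =
  (q ^ Lambda n r (tagnat.Rank a j) (tagnat.Rank b k)) *: (chi b k * chi a j).
Proof. by rewrite -[LHS]piM -[_ * _ in RHS]piM -piZ; apply/pi_presentedP/c_rel/ql_comm. Qed.

End QuasiLaurent.

(** * Centers and generated subalgebras *)

Local Open Scope classical_set_scope.

Definition alg_center (A : pzRingType) : set A :=
  [set a | forall b, GRing.comm a b].
Arguments alg_center A : clear implicits.

Definition subalg_gen (K : fieldType) (A : algType K) (S : set A) : set A :=
  smallest (fun B : set A => GRing.subalg_closed (mem B)) S.

Section CentralElement.
Variables (K : fieldType) (q : K) (q_neq0 : q != 0) (m : nat).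

(* With [n = m.+1], the last row and the last column are both [ord_max]; the
   ordinals [g] and [k] stand for the 1-based indices [g.+1] and [k.+1]. *)
Definition Zelt : quasi_laurent q_neq0 m.+1 m.+1 :=
  (\prod_(g < m.+1) chi q_neq0 g ord_max ^ ((-1) ^+ g.+1 : int)) *
  \prod_(k < m) chi q_neq0 ord_max (widen_ord (leqnSn m) k)
    ^ ((-1) ^+ k.+1 : int).

Lemma Zelt_unit : Zelt \is a GRing.unit.
Proof.
have chiXz_unit a j (z : int) : chi q_neq0 a j ^ z \is a GRing.unit.
  by move=> *; apply: unitrXz; apply: chi_unit.
by rewrite unitrMl; apply: rpred_prod => *; apply: chiXz_unit.
Qed.

End CentralElement.

(* Main.v *)
Require Import Defs.
From mathcomp Require Import all_boot all_order all_algebra.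
From mathcomp Require Import classical_sets reals complex.
From mathcomp Require Import boolp ring zify.

(** The quasi-Laurent algebra is a quantum torus: up to powers of [q] its
    Laurent monomials [X^v] multiply like the lattice of exponents, they form a
    basis (independence is seen on the action [ql_act]), and conjugation by a
    generator multiplies [X^v] by a power of [q] with exponent an entry of
    [v *m Lambda]. As [q] is not a root of unity, the center is spanned by the
    [X^v] with [v *m Lambda = 0].

    Since [TT] is unitriangular, [v *m Lambda = 0] iff [w = v *m TT^T] satisfies
    [w *m HD = 0], which says that for each position [(a, i)] the entries of [w]
    strictly above row [a] and weakly right of column [i] have the same sum as
    those strictly below row [a] and weakly left of column [i]. In terms of the
    sums [F a i] over the upper left [a x i] corners this is the recurrence
    [F a.+1 i.+1 = F a i + F n i.+1 - F a n] along diagonals. Following the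
    diagonals up to the last column and to the last row gives
    [F a n = F n (n + 1 - a)] and [F a n = F n (n - 1 - a)]; hence the row and
    column sums are 2-periodic and, for odd [n], [w] is a multiple of the
    checkerboard [(-1)^(a + i)], which corresponds to the exponent of [Z]. *)

Set Implicit Arguments.
Unset Strict Implicit.
Unset Printing Implicit Defensive.

Import Order.TTheory GRing.Theory.

Local Open Scope ring_scope.

(** * Quantum tori *)

Section QuantumTorus.
Variables (K : fieldType) (q : K) (A : unitAlgType K).
Hypothesis q_neq0 : q != 0.

Definition qcomm (k : int) (a b : A) := a * b = q ^ k *: (b * a).

Lemma qcommM k l a b c : qcomm k a b -> qcomm l a c -> qcomm (k + l) a (b * c).
Proof.
rewrite /qcomm => ab ac.
by rewrite mulrA ab -scalerAl -(mulrA b a) ac -scalerAr scalerA mulrA expfzDr.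
Qed.

Lemma qcomm1 a : qcomm 0 a 1.
Proof. by rewrite /qcomm mulr1 mul1r expr0z scale1r. Qed.

Lemma qcomm_sym k a b : qcomm k a b -> qcomm (- k) b a.
Proof.
by rewrite /qcomm => ->; rewrite scalerA -expfzDr// addNr expr0z scale1r.
Qed.

Lemma qcommV k a b : b \is a GRing.unit -> qcomm k a b -> qcomm (- k) a b^-1.
Proof.
move=> bU /qcomm_sym; rewrite /qcomm => ba.
by apply: (mulrI bU); rewrite mulrA ba -scalerAl -scalerAr mulrK// mulVKr.
Qed.

Lemma qcommXn k a b (i : nat) : qcomm k a b -> qcomm (k * i%:Z) a (b ^+ i).
Proof.
move=> ab; elim: i => [|i IH]; first by rewrite mulr0 expr0; apply: qcomm1.
by rewrite exprS intS mulrDr mulr1; apply: qcommM.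
Qed.

Lemma qcommXz k a b (z : int) :
  b \is a GRing.unit -> qcomm k a b -> qcomm (k * z) a (b ^ z).
Proof.
move=> bU ab; case: z => i; first exact: qcommXn.
rewrite NegzE mulrN -exprnN.
by apply: qcommV; [rewrite unitrX | apply: qcommXn].
Qed.

Lemma qcomm_prod (I : Type) (s : seq I) (k : I -> int) a (f : I -> A) :
  (forall i, qcomm (k i) a (f i)) ->
  qcomm (\sum_(i <- s) k i) a (\prod_(i <- s) f i).
Proof.
move=> af; elim: s => [|i s IH]; first by rewrite !big_nil; apply: qcomm1.
by rewrite !big_cons; apply: qcommM.
Qed.

Lemma prodrM_qcomm (I : Type) (s : seq I) (k : I -> I -> int) (f g : I -> A) :
  (forall i j, qcomm (k i j) (f i) (g j)) ->
  exists z : int, (\prod_(i <- s) f i) * (\prod_(i <- s) g i) =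
    q ^ z *: \prod_(i <- s) (f i * g i).
Proof.
move=> fg; elim: s => [|i s [z IH]].
  by exists 0; rewrite !big_nil mulr1 expr0z scale1r.
(* [g i] has to pass the product of the [f j]. As [qcomm_prod] takes products on the right only,
   symmetry is applied before and after it. *)
have gf := qcomm_sym (qcomm_prod s (fun j => qcomm_sym (fg j i))).
eexists (_ + z); rewrite !big_cons mulrA -(mulrA (f i)) gf.
by rewrite -scalerAr -scalerAl mulrA -(mulrA _ (\prod_(_ <- _) _)) IH -scalerAr
  scalerA -expfzDr.
Qed.

(** * Laurent monomials in q-commuting units *)

Section Monomials.
Variables (N : nat) (x : 'I_N -> A) (L : 'M[int]_N).
Hypothesis x_unit : forall s, x s \is a GRing.unit.
Hypothesis x_comm : forall s t, qcomm (L s t) (x s) (x t).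

Definition monomial (v : 'rV[int]_N) : A := \prod_(s < N) x s ^ v 0 s.

Lemma monomial_unit v : monomial v \is a GRing.unit.
Proof. by apply: rpred_prod => s _; apply: unitrXz. Qed.

Lemma monomial0 : monomial 0 = 1.
Proof. by rewrite /monomial big1// => s _; rewrite mxE expr0z. Qed.

Lemma monomial_delta s : monomial (delta_mx 0 s) = x s.
Proof.
have E t : x t ^ (delta_mx 0 s : 'rV[int]_N) 0 t = if t == s then x s else 1.
  by rewrite mxE eqxx /=; case: eqVneq => [->|]; rewrite ?expr1z ?expr0z.
rewrite /monomial (eq_bigr _ (fun t _ => E t)) {E}.
by rewrite -big_mkcond big_pred1_eq.
Qed.

(* The order of the factors matters only up to a power of [q], so monomials
   are handled up to such a power. *)
Definition is_monomial v (u : A) := exists k : int, u = q ^ k *: monomial v.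

Lemma is_monomial_monomial v : is_monomial v (monomial v).
Proof. by exists 0; rewrite expr0z scale1r. Qed.

Lemma monomial_qcomm v s :
  qcomm ((v *m L) 0 s) (monomial v) (x s).
Proof.
rewrite -[(v *m L) 0 s]opprK; apply: qcomm_sym.
have -> : - (v *m L) 0 s = \sum_t (- L t s) * v 0 t.
  by rewrite mxE -sumrN; apply: eq_bigr => t _; rewrite mulNr mulrC.
by apply: qcomm_prod => t; apply: qcommXz => //; apply: qcomm_sym.
Qed.

Lemma is_monomialM v w u u' :
  is_monomial v u -> is_monomial w u' -> is_monomial (v + w) (u * u').
Proof.
move=> [k ->] [l ->].
have xx s t : qcomm (L s t * v 0 s * w 0 t) (x s ^ v 0 s) (x t ^ w 0 t).
  apply: qcommXz => //; rewrite -[_ * _]opprK -mulNr.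
  by apply/qcomm_sym/qcommXz/qcomm_sym.
have [z E] := prodrM_qcomm (index_enum _) xx.
exists (k + l + z); rewrite -scalerAl -scalerAr E !scalerA -!expfzDr//.
by congr (_ *: _); apply: eq_bigr => s _; rewrite mxE exprzDr.
Qed.

Lemma is_monomial1 : is_monomial 0 1.
Proof. by rewrite -monomial0; apply: is_monomial_monomial. Qed.

Lemma is_monomial_gen s : is_monomial (delta_mx 0 s) (x s).
Proof. by rewrite -monomial_delta; apply: is_monomial_monomial. Qed.

(** The product of the monomials of [v] and [- v] is a power of [q], so they are inverse to each
    other up to that power. *)
Lemma is_monomialV v u : is_monomial v u -> is_monomial (- v) u^-1.
Proof.
move=> [k ->]; have [l] := is_monomialM (is_monomial_monomial v)
  (is_monomial_monomial (- v)).
rewrite subrr monomial0 => E; exists (- k - l).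
have qU m : q ^ m \is a GRing.unit by rewrite unitfE expfz_neq0.
rewrite invrZ ?qU ?monomial_unit// invr_expz expfzDr// -scalerA.
congr (_ *: _); apply: (mulrI (monomial_unit v)).
rewrite -scalerAr E divrr ?monomial_unit//.
by rewrite scalerA -expfzDr// addNr expr0z scale1r.
Qed.

Lemma is_monomialX v u (z : int) :
  is_monomial v u -> is_monomial (v *~ z) (u ^ z).
Proof.
move=> vu; have nat_case (i : nat) : is_monomial (v *~ i%:Z) (u ^+ i).
  elim: i => [|i IH]; first by rewrite expr0; apply: is_monomial1.
  by rewrite exprS intS mulrzDr; apply: is_monomialM.
case: z => i; first exact: nat_case.
by rewrite NegzE mulrNz -exprnN; apply: is_monomialV.
Qed.

Lemma is_monomial_prod (I : Type) (r : seq I) (v : I -> 'rV[int]_N)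
    (u : I -> A) :
  (forall i, is_monomial (v i) (u i)) ->
  is_monomial (\sum_(i <- r) v i) (\prod_(i <- r) u i).
Proof.
move=> vu; elim: r => [|i r IH]; first by rewrite !big_nil; apply: is_monomial1.
by rewrite !big_cons; apply: is_monomialM.
Qed.

Definition monomial_span (u : A) :=
  exists s : seq (K * 'rV[int]_N), u = \sum_(p <- s) p.1 *: monomial p.2.

Lemma monomial_span_is_monomial v u : is_monomial v u -> monomial_span u.
Proof. by move=> [k ->]; exists [:: (q ^ k, v)]; rewrite big_seq1. Qed.

Lemma monomial_spanD u u' :
  monomial_span u -> monomial_span u' -> monomial_span (u + u').
Proof. by move=> [s ->] [s' ->]; exists (s ++ s'); rewrite big_cat. Qed.

Lemma monomial_spanZ a u : monomial_span u -> monomial_span (a *: u).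
Proof.
move=> [s ->]; exists [seq (a * p.1, p.2) | p <- s].
by rewrite big_map scaler_sumr; apply: eq_bigr => p _; rewrite scalerA.
Qed.

Lemma monomial_span_sum (I : Type) (r : seq I) (u : I -> A) :
  (forall i, monomial_span (u i)) -> monomial_span (\sum_(i <- r) u i).
Proof.
move=> us; elim: r => [|i r IH]; first by exists [::]; rewrite !big_nil.
by rewrite big_cons; apply: monomial_spanD.
Qed.

Lemma monomial_spanM u u' :
  monomial_span u -> monomial_span u' -> monomial_span (u * u').
Proof.
move=> [s ->] [s' ->]; rewrite mulr_suml; apply: monomial_span_sum => p.
rewrite mulr_sumr; apply: monomial_span_sum => p'.
rewrite -scalerAl -scalerAr; do 2!apply: monomial_spanZ.
exact: (monomial_span_is_monomial
  (is_monomialM (is_monomial_monomial _) (is_monomial_monomial _))).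
Qed.

(** Adding up the coefficients of equal exponents gives the duplicate-free form to which
    [monomial_free] applies. *)
Lemma monomial_span_uniq u : monomial_span u ->
  exists (r : seq 'rV[int]_N) (a : 'rV[int]_N -> K),
    uniq r /\ u = \sum_(v <- r) a v *: monomial v.
Proof.
move=> [s ->]; exists (undup (unzip2 s)).
exists (fun v => \sum_(p <- s | p.2 == v) p.1); split; first exact: undup_uniq.
under [RHS]eq_bigr do rewrite big_mkcond scaler_suml /=.
rewrite exchange_big /=; apply: eq_big_seq => p ps.
rewrite (bigD1_seq p.2) ?undup_uniq ?mem_undup ?map_f//= eqxx big1 ?addr0//.
by move=> v; rewrite eq_sym => /negPf->; rewrite scale0r.
Qed.

Hypothesis q_not_root : forall k : nat, (0 < k)%N -> ~~ k.-unity_root q.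
Hypothesis x_span : forall u, monomial_span u.
Hypothesis monomial_free : forall r (a : 'rV[int]_N -> K), uniq r ->
  \sum_(v <- r) a v *: monomial v = 0 -> forall v, v \in r -> a v = 0.

Lemma expfz_eq1 (k : int) : q ^ k = 1 -> k = 0.
Proof.
have nat_case (i : nat) : q ^+ i = 1 -> i = 0%N.
  case: i => // i E; have := @q_not_root i.+1 isT.
  by rewrite unity_rootE E eqxx.
case: k => i /=; first by move/nat_case->.
rewrite NegzE -exprnN => /(congr1 GRing.inv).
by rewrite invrK invr1 => /nat_case.
Qed.

(* Conjugation by a generator acts diagonally on the monomials, so that each
   monomial occurring in a central element is itself central. *)
Lemma center_monomials u : alg_center A u ->
  exists (r : seq 'rV[int]_N) (a : 'rV[int]_N -> K),
    u = \sum_(v <- r) a v *: monomial v /\ {in r, forall v, v *m L = 0}.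
Proof.
move=> uC; have [r [a [r_uniq uE]]] := monomial_span_uniq (x_span u).
exists [seq v <- r | v *m L == 0], a; split; last first.
  by move=> v; rewrite mem_filter => /andP[/eqP].
rewrite uE (bigID (fun v => v *m L == 0)) /= big_filter.
rewrite [X in _ + X]big_seq_cond.
rewrite [X in _ + X]big1 ?addr0// => v /andP[vr /eqP vL].
have [s vLs] : exists s, (v *m L) 0 s <> 0.
  apply: contrapT => v0; apply: vL; apply/rowP => s.
  by rewrite [RHS]mxE; apply: contrapT => vLs; apply: v0; exists s.
have := uC (x s); rewrite /GRing.comm uE mulr_suml mulr_sumr => /eqP.
rewrite -subr_eq0 -sumrB.
(* Moving [x s] to the left turns the commutator into [x s] times a combination of the same
   monomials; freeness then makes each new coefficient vanish. *)
have -> : \sum_(w <- r) (a w *: monomial w * x s - x s * (a w *: monomial w)) =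
    x s * \sum_(w <- r) (a w * (q ^ (w *m L) 0 s - 1)) *: monomial w.
  rewrite mulr_sumr; apply: eq_bigr => w _.
  rewrite -scalerAl -!scalerAr (monomial_qcomm w s) scalerA -scalerBl.
  by rewrite mulrBr mulr1.
rewrite -[X in _ == X](mulr0 (x s)) => /eqP/(mulrI (x_unit s)).
move=> /(monomial_free r_uniq)/(_ v vr)/eqP; rewrite mulf_eq0 => /orP[/eqP->|].
  by rewrite scale0r.
by rewrite subr_eq0 => /eqP/expfz_eq1.
Qed.

End Monomials.
End QuantumTorus.

(** * Balanced quadrant sums *)

Section DiagonalRecurrence.
Variables (n : nat) (F : nat -> nat -> int).
Hypotheses (F0i : forall i, F 0 i = 0) (Fa0 : forall a, F a 0 = 0).
Hypothesis Frec : forall a i, (a < n)%N -> (i < n)%N ->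
  F a.+1 i.+1 = F a i + F n i.+1 - F a n.

(** Partial sums of the two increments in [Frec]; the shift in [cols] matches [F n i.+1] there. *)
Let rows k := \sum_(0 <= t < k) F t n.
Let cols k := \sum_(0 <= t < k) F n t.+1.

Let rowsS k : rows k.+1 = rows k + F k n.
Proof. by rewrite /rows big_nat_recr. Qed.

Let colsS k : cols k.+1 = cols k + F n k.+1.
Proof. by rewrite /cols big_nat_recr. Qed.

(** The recurrence telescopes from the point [(0, k)], where [F] vanishes. *)
Lemma upper_diagonal k t : (k + t <= n)%N ->
  F t (k + t) = cols (k + t) - cols k - rows t.
Proof.
elim: t => [|t IH] kt; first by rewrite F0i addn0 /rows big_geq// subrr subr0.
rewrite addnS Frec; [|lia..]; rewrite IH; last lia.
by rewrite colsS rowsS; ring.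
Qed.

Lemma lower_diagonal k t : (k + t <= n)%N ->
  F (k + t) t = cols t - (rows (k + t) - rows k).
Proof.
elim: t => [|t IH] kt; first by rewrite Fa0 addn0 /cols big_geq// subrr subr0.
rewrite addnS Frec; [|lia..]; rewrite IH; last lia.
by rewrite colsS rowsS; ring.
Qed.

(** The diagonals from [(0, k)] and [(0, k.+1)] meet the last column in consecutive rows. In the
    difference of their closed forms all but one term of each partial sum cancels. *)
Lemma last_col_last_row k t : (k + t.+1 = n)%N -> F t.+1 n = F n k.+1.
Proof.
move=> kt; have := @upper_diagonal k t.+1; have := @upper_diagonal k.+1 t.
rewrite addSnnS kt leqnn => /(_ isT) E1 /(_ isT) E2.
by move: E1 E2; rewrite colsS rowsS => ->; lia.
Qed.

(** Same comparison for the neighbouring diagonals from [(k, 0)] and [(k.+1, 0)], which meet the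
    last row. *)
Lemma last_row_last_col k t : (k + t.+1 = n)%N -> F n t = F k n.
Proof.
move=> kt; have := @lower_diagonal k t.+1; have := @lower_diagonal k.+1 t.
rewrite addSnnS kt leqnn => /(_ isT) E1 /(_ isT) E2.
by move: E1 E2; rewrite colsS rowsS => ->; lia.
Qed.

Lemma last_col_periodic a : (a.+2 <= n)%N -> F a.+2 n = F a n.
Proof.
move=> an; rewrite (@last_col_last_row (n - a.+2)); last by lia.
by rewrite (@last_row_last_col a); [| lia].
Qed.

Hypothesis n_odd : odd n.

Lemma last_colE a : (a <= n)%N -> F a n = F n n *+ odd a.
Proof.
have even_case b : (b.*2 <= n)%N -> F b.*2 n = 0.
  by elim: b => [|b IH] bn; rewrite ?F0i// doubleS last_col_periodic ?IH//; lia.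
have odd_case b : (b.*2.+1 <= n)%N -> F b.*2.+1 n = F 1 n.
  by elim: b => [|b IH] bn //; rewrite doubleS last_col_periodic ?IH//; lia.
(* Since [n] is odd, the common value at odd rows is the corner value [F n n]. *)
have F1n : F n n = F 1 n.
  have := odd_case n./2; rewrite -add1n -[X in (X + _)%N]/(nat_of_bool true).
  by rewrite -n_odd odd_double_half; apply.
rewrite F1n -(odd_double_half a); case: (odd a) => an /=.
  by rewrite add1n odd_case//= odd_double.
by rewrite add0n even_case// odd_double.
Qed.

Lemma last_rowE i : (i <= n)%N -> F n i = F n n *+ odd i.
Proof.
case: i => [|i] i_n; first by rewrite Fa0.
rewrite -(@last_col_last_row i (n - i.+1)); last by lia.
(* For odd [n], the numbers [n - i] and [i.+1] have the same parity. *)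
by rewrite last_colE; [congr (_ *+ nat_of_bool _) |]; lia.
Qed.

Lemma diagonal_recurrenceE a i : (a <= n)%N -> (i <= n)%N ->
  F a i = F n n *+ (odd a && odd i).
Proof.
elim: a i => [|a IH] [|i] an i_n; rewrite ?F0i ?Fa0 ?andbF//.
rewrite Frec// IH 1?ltnW// (@last_rowE i.+1)// (@last_colE a) 1?ltnW//=.
by case: (odd a); case: (odd i); rewrite /= ?mulr0n ?mulr1n; lia.
Qed.

End DiagonalRecurrence.

Definition quadrant (W : nat -> nat -> int) a i :=
  \sum_(0 <= b < a) \sum_(0 <= j < i) W b j.

Section Checkerboard.
Variables (n : nat) (W : nat -> nat -> int).

Lemma quadrant_ne a i : (i <= n)%N ->
  \sum_(0 <= b < a) \sum_(i <= j < n) W b j =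
  quadrant W a n - quadrant W a i.
Proof.
move=> i_n; rewrite -sumrB; apply: eq_bigr => b _.
by rewrite (big_cat_nat (leq0n i) i_n) //= addrAC subrr add0r.
Qed.

Lemma quadrant_sw a i : (a <= n)%N ->
  \sum_(a <= b < n) \sum_(0 <= j < i) W b j =
  quadrant W n i - quadrant W a i.
Proof.
move=> an; rewrite [quadrant W n i](big_cat_nat (leq0n a) an) //=.
by rewrite addrAC subrr add0r.
Qed.

Lemma quadrantS a i :
  W a i = quadrant W a.+1 i.+1 - quadrant W a i.+1 - quadrant W a.+1 i
    + quadrant W a i.
Proof.
have row b : quadrant W b.+1 i.+1 - quadrant W b.+1 i =
    quadrant W b i.+1 - quadrant W b i + W b i.
  by rewrite /quadrant !(big_nat_recr b) //= (big_nat_recr i) //=; ring.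
by have := row a; lia.
Qed.

(* With [F] the quadrant sums of [W], the balance of the north-east and
   south-west quadrants is [F a.+1 i.+1 = F a i + F n i.+1 - F a n]. *)
Definition balanced := forall a i, (a < n)%N -> (i < n)%N ->
  \sum_(0 <= b < a) \sum_(i <= j < n) W b j =
  \sum_(a.+1 <= b < n) \sum_(0 <= j < i.+1) W b j.

Lemma balanced_checkerboard : odd n -> balanced ->
  forall a i, (a < n)%N -> (i < n)%N -> W a i = (-1) ^+ (a + i) * W 0 0.
Proof.
move=> n_odd W_bal; have Frec a i : (a < n)%N -> (i < n)%N ->
    quadrant W a.+1 i.+1 = quadrant W a i + quadrant W n i.+1 - quadrant W a n.
  move=> an i_n; have := W_bal a i an i_n.
  by rewrite quadrant_ne ?quadrant_sw; lia.
have F0i i : quadrant W 0 i = 0 by rewrite /quadrant big_geq.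
have Fa0 a : quadrant W a 0 = 0.
  by rewrite /quadrant big1// => b _; rewrite big_geq.
have FE := diagonal_recurrenceE F0i Fa0 Frec n_odd.
have WE a i : (a < n)%N -> (i < n)%N ->
    W a i = (-1) ^+ (a + i) * quadrant W n n.
  move=> an i_n; have [an' i_n'] := (ltnW an, ltnW i_n).
  rewrite quadrantS (FE a.+1 i.+1)// (FE a i.+1)// (FE a.+1 i)// (FE a i)//=.
  rewrite -signr_odd oddD.
  by case: (odd a); case: (odd i); rewrite /= ?mulr0n ?mulr1n; lia.
(* The case [a = i = 0] of [WE] identifies the total sum with [W 0 0]. *)
move=> a i an i_n; rewrite WE// WE ?expr0 ?mul1r//; lia.
Qed.

(** For odd [n] both quadrant sums equal [W 0 0] when [a] is odd and [i] even, and 0 otherwise. *)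
Lemma checkerboard_balanced :
  (forall a i, (a < n)%N -> (i < n)%N -> W a i = (-1) ^+ (a + i) * W 0 0) ->
  odd n -> balanced.
Proof.
move=> WE n_odd.
have FE a i : (a <= n)%N -> (i <= n)%N ->
    quadrant W a i = W 0 0 *+ (odd a && odd i).
  elim: a => [|a IH] an i_n; first by rewrite /quadrant big_geq.
  rewrite /quadrant big_nat_recr //= -/(quadrant W a i) (IH (ltnW an) i_n) {IH}.
  elim: i i_n => [|i IH] i_n; first by rewrite big_geq ?andbF.
  rewrite big_nat_recr //= addrA.
  move/(canRL (addKr _)): (IH (ltnW i_n)) => ->.
  rewrite (WE a i)// -signr_odd oddD.
  by case: (odd a); case: (odd i); rewrite /= ?mulr0n ?mulr1n; lia.
move=> a i an i_n; rewrite (quadrant_ne _ (ltnW i_n)) quadrant_sw//.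
rewrite !FE ?(ltnW an) ?(ltnW i_n)//= n_odd.
by case: (odd a); case: (odd i); rewrite /= ?mulr0n ?mulr1n; lia.
Qed.

End Checkerboard.

(** * The kernel of Lambda *)

Lemma sum_Rank (V : nmodType) n (p : 'I_n -> nat) (F : 'I_(\sum_i p i) -> V) :
  \sum_s F s = \sum_a \sum_(j < p a) F (tagnat.Rank a j).
Proof.
rewrite (reindex _ tagnat.rank_bij_on).
rewrite (sig_big_dep xpredT (fun=> xpredT) (fun a j => F (tagnat.Rank a j))) /=.
by apply: eq_bigr => -[a j] _; rewrite tagnat.rankE.
Qed.

Section Entries.
Variables (n r : nat).
Implicit Types s t : 'I_(\sum_(a < n) r).

Lemma mxblock_Rank (T : Type) p p' (p_ : 'I_p -> nat) (p'_ : 'I_p' -> nat)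
    (B : forall a b, 'M[T]_(p_ a, p'_ b)) a b (i : 'I_(p_ a)) (j : 'I_(p'_ b)) :
  (\mxblock_(a, b) B a b) (tagnat.Rank a i) (tagnat.Rank b j) = B a b i j.
Proof. by move/matrixP/(_ i j): (mxblockK B a b) => <-; rewrite [RHS]mxE. Qed.

Lemma HDE (a b : 'I_n) (i j : 'I_r) :
  HD n r (tagnat.Rank a i) (tagnat.Rank b j) =
    if (a < b)%N then (j <= i)%:R else if (b < a)%N then - (i <= j)%:R else 0.
Proof.
rewrite [LHS]mxblock_Rank; case: ltngtP => ab; rewrite !mxE //.
all: by case: leqP; rewrite ?opprK ?oppr0.
Qed.

Lemma shiftmxXE k (i j : 'I_r) : (shiftmx r ^+ k) i j = (i + k == j)%N%:R.
Proof.
elim: k i j => [|k IH] i j; first by rewrite expr0 mxE addn0.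
rewrite exprSr mxE.
have [ikj|ikj] := eqVneq (i + k.+1)%N j.
  have ik : (i + k < r)%N by have := ltn_ord j; lia.
  rewrite (bigD1 (Ordinal ik)) //= IH mxE /= eqxx -addnS ikj eqxx mulr1.
  rewrite big1 ?addr0// => l; rewrite -val_eqE /= IH eq_sym => /negPf->.
  by rewrite mul0r.
rewrite big1// => l _; rewrite IH mxE.
have [ikl|] := eqVneq (i + k)%N l; last by rewrite mul0r.
by rewrite -ikl -addnS (negPf ikj) mulr0.
Qed.

Lemma TTE (a b : 'I_n) (i j : 'I_r) :
  TT n r (tagnat.Rank a i) (tagnat.Rank b j) =
    ((a <= b) && (i + (b - a) == j))%N%:R.
Proof.
by rewrite [LHS]mxblock_Rank; case: leqP => ab; rewrite ?shiftmxXE// mxE.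
Qed.

(** In the order of [tagnat.Rank] the transpose of [TT] is lower triangular with unit diagonal: a
    nonzero entry on the wrong side would force equal blocks, hence equal positions. *)
Lemma TT_unit : TT n r \in unitmx.
Proof.
have RankP s : exists a (i : 'I_r), s = tagnat.Rank a i.
  by exists (tagnat.sig1 s), (tagnat.sig2 s); rewrite tagnat.sig2K.
rewrite -unitmx_tr unitmxE det_trig; last first.
  apply/is_trig_mxP => s t; rewrite mxE.
  have [[a [i ->]] [b [j ->]]] := (RankP s, RankP t); rewrite TTE => ab.
  case: andP => //= -[ba /eqP ij].
  have : (tagnat.Rank (p_ := fun=> r) a i <= tagnat.Rank b j)%O.
    by rewrite leEord ltnW.
  move=> /tagnat.le_sig1; rewrite !tagnat.Rank1K leEord => ba'.
  have ba_eq : b = a by apply/val_inj/anti_leq; rewrite ba.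
  have ji : j = i by apply/val_inj; rewrite /= -ij ba_eq subnn addn0.
  by move: ab; rewrite ba_eq ji ltnn.
rewrite big1 ?unitr1// => s _; rewrite mxE.
by have [a [i ->]] := RankP s; rewrite TTE leqnn subnn addn0 eqxx.
Qed.

End Entries.

Section Kernel.
Variable m : nat.
Local Notation n := m.+1.
Local Notation lat := 'rV[int]_(\sum_(a < n) n).

(** Natural number indices put [w] in the form used by [balanced], which reads only entries in
    range, where [inord] is faithful. *)
Definition entry (w : lat) (a i : nat) : int :=
  w 0 (tagnat.Rank (inord a) (inord i)).

Lemma entryE (w : lat) (a i : 'I_n) : w 0 (tagnat.Rank a i) = entry w a i.
Proof. by rewrite /entry !inord_val. Qed.

(** Column [(b, j)] of [HD] is the indicator of the north-east quadrant minus that of the south-west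
    quadrant, and vanishes on row [b]. *)
Lemma row_HD_eq0 (w : lat) : w *m HD n n = 0 <-> balanced n (entry w).
Proof.
have E (b j : 'I_n) : (w *m HD n n) 0 (tagnat.Rank b j) =
    \sum_(0 <= a < b) \sum_(j <= i < n) entry w a i -
    \sum_(b.+1 <= a < n) \sum_(0 <= i < j.+1) entry w a i.
  rewrite mxE sum_Rank; under eq_bigr do under eq_bigr do rewrite entryE HDE.
  rewrite -(big_mkord xpredT (fun a => \sum_(i < n) entry w a i *
    (if (a < b)%N then (j <= i)%:R else if (b < a)%N then - (i <= j)%:R else 0))).
  rewrite (big_cat_nat (leq0n b) (ltnW (ltn_ord b))) /= [X in _ + X]big_ltn//.
  rewrite [X in _ + (X + _)]big1 ?add0r; last first.
    by move=> i _; rewrite ltnn mulr0.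
  congr (_ + _).
    apply: eq_big_nat => a /andP[_ ab]; rewrite ab.
    rewrite -(big_mkord xpredT (fun i => entry w a i * (j <= i)%:R)).
    rewrite (big_cat_nat (leq0n j) (ltnW (ltn_ord j))) /= big_nat big1 ?add0r.
      by apply: eq_big_nat => i /andP[-> _]; rewrite mulr1.
    by move=> i /andP[_ ij]; rewrite leqNgt ij mulr0.
  rewrite -sumrN; apply: eq_big_nat => a /andP[ab _].
  rewrite ab ltnNge ltnW//= -sumrN.
  rewrite -(big_mkord xpredT (fun i => entry w a i * - (i <= j)%:R)).
  rewrite (big_cat_nat (leq0n j.+1) (ltn_ord j)) /= [X in _ + X]big_nat.
  rewrite [X in _ + X]big1 ?addr0.
    by apply: eq_big_nat => i /andP[_]; rewrite ltnS => ->; rewrite mulrN1.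
  by move=> i /andP[ij _]; rewrite leqNgt ij oppr0 mulr0.
split=> [w0 b j bn jn|w_bal].
  by apply/eqP; rewrite -subr_eq0 -(E (Ordinal bn) (Ordinal jn)) w0 mxE.
apply/rowP => s; rewrite -(tagnat.sig2K s) E w_bal ?subrr ?mxE//.
Qed.

(** The exponent of [Zelt], in the shape of its defining product so that the two match factor by
    factor. *)
Definition Zexp : lat :=
  \sum_(g < n) (delta_mx 0 (tagnat.Rank g ord_max) : lat) *~ (-1) ^+ g.+1 +
  \sum_(k < m) (delta_mx 0 (tagnat.Rank ord_max (widen_ord (leqnSn m) k)) : lat)
    *~ (-1) ^+ k.+1.

Hypothesis n_odd : odd n.

(* The diagonal through [(a, i)] meets the union of the last row and the last
   column exactly once. *)
Lemma Zexp_TT (a i : 'I_n) :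
  (Zexp *m (TT n n)^T) 0 (tagnat.Rank a i) = (-1) ^+ (a + i).+1.
Proof.
have E t (z : int) s :
    ((delta_mx 0 t : lat) *~ z *m (TT n n)^T) 0 s = z * TT n n s t.
  by rewrite -scaler_int -scalemxAl -rowE !mxE intz.
have am := ltn_ord a; have im := ltn_ord i.
rewrite mulmxDl !mulmx_suml mxE !summxE.
transitivity (
    \sum_(g < n) (-1) ^+ g.+1 * ((a <= g)%N && (i + (g - a) == m)%N)%:R +
    \sum_(k < m) (-1) ^+ k.+1 * ((a <= m)%N && (i + (m - a) == k)%N)%:R : int).
  by congr (_ + _); apply: eq_bigr => ? _; rewrite E TTE.
(* Diagonals with [a <= i] end in the last column at row [a + m - i], the others in the last row at
   column [i + m - a]. As [m] is even, both numbers have the parity of [a + i]. The corner belongs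
   to the first sum. *)
rewrite -[RHS]signr_odd; have [ai|ia] := leqP a i.
  rewrite [X in _ + X]big1 ?addr0; last first.
    move=> k _; have km := ltn_ord k.
    by rewrite (_ : _ && _ = false) ?mulr0//=; lia.
  have gn : (a + m - i < n)%N by lia.
  rewrite (bigD1 (Ordinal gn)) //= big1 ?addr0.
    rewrite (_ : _ && _ = true) ?mulr1; last by lia.
    by rewrite -signr_odd; congr (_ ^+ nat_of_bool _); lia.
  move=> g; rewrite -val_eqE /= => ga.
  by rewrite (_ : _ && _ = false) ?mulr0//=; lia.
rewrite big1 ?add0r; last first.
  move=> g _; have gm := ltn_ord g.
  by rewrite (_ : _ && _ = false) ?mulr0//=; lia.
have km : (i + m - a < m)%N by lia.
rewrite (bigD1 (Ordinal km)) //= big1 ?addr0.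
  rewrite (_ : _ && _ = true) ?mulr1; last by lia.
  by rewrite -signr_odd; congr (_ ^+ nat_of_bool _); lia.
move=> k; rewrite -val_eqE /= => ki.
by rewrite (_ : _ && _ = false) ?mulr0//=; lia.
Qed.

Lemma Zexp_checkerboard a i : (a < n)%N -> (i < n)%N ->
  entry (Zexp *m (TT n n)^T) a i = (-1) ^+ (a + i).+1.
Proof.
by move=> an i_n; rewrite -(entryE _ (Ordinal an) (Ordinal i_n)) Zexp_TT.
Qed.

Lemma mul_Zexp_Lambda : Zexp *m Lambda n n = 0.
Proof.
have /row_HD_eq0 E : balanced n (entry (Zexp *m (TT n n)^T)).
  apply: checkerboard_balanced n_odd => a i an i_n.
  by rewrite !Zexp_checkerboard// exprS mulN1r expr1 mulrN1.
by rewrite /Lambda mulr2n mulmxDr mulmxDl mulmxDr !mulmxA E mul0mx addr0.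
Qed.

Lemma Lambda_kernel (v : lat) : v *m Lambda n n = 0 -> exists k, v = Zexp *~ k.
Proof.
move=> vL; have TU : (TT n n)^T \in unitmx by rewrite unitmx_tr TT_unit.
have : v *m (TT n n)^T *m HD n n = 0.
  (* [TT] cancels on the right; [lia] then divides by the factor 2 of [Lambda]. *)
  apply: (can_inj (mulmxK (TT_unit n n))); rewrite mul0mx; apply/rowP => s.
  move/rowP/(_ s): vL; rewrite /Lambda mulr2n mulmxDr mulmxDl mulmxDr !mulmxA.
  by rewrite !mxE; lia.
move=> /row_HD_eq0 /(balanced_checkerboard n_odd) vE.
(* The sign appears because [Zexp *m (TT n n)^T] has corner entry -1. *)
exists (- entry (v *m (TT n n)^T) 0 0); apply: (can_inj (mulmxK TU)).
apply/rowP => s; rewrite -(tagnat.sig2K s) entryE.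
rewrite (vE (tagnat.sig1 s) (tagnat.sig2 s))//.
rewrite -scaler_int -scalemxAl [RHS]mxE Zexp_TT exprS intz.
by ring.
Qed.

End Kernel.

(** * The center *)

Section QuasiLaurent.
Variables (K : fieldType) (q : K) (q_neq0 : q != 0) (n r : nat).
Local Notation QL := (quasi_laurent q_neq0 n r).
Local Notation idx := 'I_(\sum_(a < n) r).
Local Notation lat := 'rV[int]_(\sum_(a < n) r).

Definition minor (s : idx) : QL :=
  pi_presented (ql_rel q (r := r)) (Gen (Chi s)).

Lemma minorE s : minor s = chi q_neq0 (tagnat.sig1 s) (tagnat.sig2 s).
Proof. by rewrite /chi tagnat.sig2K. Qed.

Lemma minor_unit s : minor s \is a GRing.unit.
Proof. by rewrite minorE chi_unit. Qed.

Lemma minorV s : (minor s)^-1 = pi_presented (ql_rel q (r := r)) (Gen (ChiV s)).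
Proof. by rewrite minorE -chiVE /chiV tagnat.sig2K. Qed.

Lemma minor_qcomm s t : qcomm q (Lambda n r s t) (minor s) (minor t).
Proof. by rewrite /qcomm !minorE chi_comm !tagnat.sig2K. Qed.

(** Every element is the class of an expression, so induction on expressions applies; opposites
    reduce to scaling by -1. *)
Lemma quasi_laurentW (P : QL -> Prop) :
  (forall s, P (minor s)) -> (forall s, P (minor s)^-1) -> P 0 -> P 1 ->
  (forall u v, P u -> P v -> P (u + v)) ->
  (forall u v, P u -> P v -> P (u * v)) ->
  (forall (a : K) u, P u -> P (a *: u)) -> forall u, P u.
Proof.
move=> Pg PV P0 P1 PD PM PZ; apply: presentedW.
elim=> [[s|s]|||x Px|x Px y Py|x Px y Py|a x Px].
- exact: Pg.
- by rewrite -minorV; apply: PV.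
- exact: P0.
- exact: P1.
- by rewrite piN -scaleN1r; apply: PZ.
- by rewrite piD; apply: PD.
- by rewrite piM; apply: PM.
- by rewrite piZ; apply: PZ.
Qed.

Lemma quasi_laurent_span (u : QL) : monomial_span minor u.
Proof.
elim/quasi_laurentW: u => [s|s|||u v|u v|a u].
- exact: monomial_span_is_monomial (is_monomial_gen q minor s).
- exact: monomial_span_is_monomial
    (is_monomialV q_neq0 minor_unit minor_qcomm (is_monomial_gen q minor s)).
- by exists [::]; rewrite big_nil.
- exact: monomial_span_is_monomial (is_monomial1 q minor).
- exact: monomial_spanD.
- exact: (monomial_spanM q_neq0 minor_unit minor_qcomm).
- exact: monomial_spanZ.
Qed.

(** * Action on functions on the lattice and independence of monomials *)

Definition act (u : QL) : (lat -> K) -> lat -> K := ql_act q (repr u).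

(** Congruent expressions act alike, so the choice of representative in [act] is immaterial. *)
Lemma act_pi x : act (pi_presented (ql_rel q (r := r)) x) = ql_act q x.
Proof. exact/(ql_act_congr q_neq0)/reprP. Qed.

Lemma actM u v f : act (u * v) f = act u (act v f).
Proof.
by elim/presentedW: u => x; elim/presentedW: v => y; rewrite -piM !act_pi.
Qed.

Lemma act1 f : act 1 f = f.
Proof. by rewrite -pi1 act_pi. Qed.

Lemma act0 f : act 0 f = fun=> 0.
Proof. by rewrite -pi0 act_pi. Qed.

Lemma actD u v f : act (u + v) f = fun l => act u f l + act v f l.
Proof.
by elim/presentedW: u => x; elim/presentedW: v => y; rewrite -piD !act_pi.
Qed.

Lemma actZ a u f : act (a *: u) f = fun l => a * act u f l.
Proof. by elim/presentedW: u => x; rewrite -piZ !act_pi. Qed.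

(** A weighted translation. The weights stay existential because independence uses only that they do
    not vanish. *)
Definition shifts (d : lat) (u : QL) := exists c : lat -> K,
  (forall l, c l != 0) /\ forall f l, act u f l = c l * f (l - d).

Lemma shiftsM d d' u u' :
  shifts d u -> shifts d' u' -> shifts (d + d') (u * u').
Proof.
move=> [c [c0 uE]] [c' [c'0 u'E]]; exists (fun l => c l * c' (l - d)).
split=> [l|f l]; first exact: mulf_neq0.
by rewrite actM uE u'E mulrA opprD addrA.
Qed.

Lemma shifts1 : shifts 0 1.
Proof.
exists (fun=> 1); split=> [l|f l]; first exact: oner_neq0.
by rewrite act1 subr0 mul1r.
Qed.

Lemma shiftsV d u : u \is a GRing.unit -> shifts d u -> shifts (- d) u^-1.
Proof.
move=> uU [c [c0 uE]]; exists (fun l => (c (l + d))^-1).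
split=> [l|f l]; first by rewrite invr_neq0.
(* Evaluating [u * u^-1] at [l + d] isolates the value of [act u^-1 f] at [l]. *)
have := uE (act u^-1 f) (l + d).
by rewrite -actM divrr// act1 addrK opprK => ->; rewrite mulKf.
Qed.

Lemma shiftsX d u (z : int) :
  u \is a GRing.unit -> shifts d u -> shifts (d *~ z) (u ^ z).
Proof.
move=> uU du; have nat_case (i : nat) : shifts (d *~ i%:Z) (u ^+ i).
  elim: i => [|i IH]; first by rewrite expr0; apply: shifts1.
  by rewrite exprS intS mulrzDr; apply: shiftsM.
case: z => i; first exact: nat_case.
by rewrite NegzE mulrNz -exprnN; apply: shiftsV; rewrite ?unitrX.
Qed.

Lemma shifts_minor s : shifts (delta_mx 0 s) (minor s).
Proof.
eexists; split; last by move=> f l; rewrite act_pi.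
by move=> l /=; rewrite expfz_neq0.
Qed.

Lemma shifts_prod (I : Type) (l : seq I) (d : I -> lat) (u : I -> QL) :
  (forall i, shifts (d i) (u i)) ->
  shifts (\sum_(i <- l) d i) (\prod_(i <- l) u i).
Proof.
move=> du; elim: l => [|i l IH]; first by rewrite !big_nil; apply: shifts1.
by rewrite !big_cons; apply: shiftsM.
Qed.

Lemma shifts_monomial v : shifts v (monomial minor v).
Proof.
rewrite [v in shifts v]row_sum_delta; apply: shifts_prod => s.
rewrite -[X in X *: _]intz scaler_int.
by apply: shiftsX; [apply: minor_unit | apply: shifts_minor].
Qed.

(* Distinct monomials send the indicator function of [0] to functions with
   distinct one-point supports. *)
Lemma quasi_laurent_free l (a : lat -> K) : uniq l ->
  \sum_(v <- l) a v *: monomial minor v = 0 -> forall v, v \in l -> a v = 0.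
Proof.
move=> l_uniq E v vl; pose f (w : lat) : K := (w == 0)%:R.
have act_sum (l' : seq lat) : act (\sum_(w <- l') a w *: monomial minor w) f v =
    \sum_(w <- l') a w * act (monomial minor w) f v.
  elim: l' => [|w l' IH]; first by rewrite !big_nil act0.
  by rewrite !big_cons actD actZ IH.
have := act_sum l; rewrite E act0 (bigD1_seq v)//= [X in _ = _ + X]big1 ?addr0.
  have [c [c0 ->]] := shifts_monomial v; rewrite /f subrr eqxx mulr1.
  by move=> /esym/eqP; rewrite mulf_eq0 (negPf (c0 v)) orbF => /eqP.
move=> w wv; have [c [_ ->]] := shifts_monomial w.
by rewrite /f subr_eq0 eq_sym (negPf wv) !mulr0.
Qed.

End QuasiLaurent.

(** * The center as a generated subalgebra *)

Section Center.
Local Open Scope classical_set_scope.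
Variables (K : fieldType) (q : K) (q_neq0 : q != 0).

Lemma alg_center_subalg (A : algType K) :
  GRing.subalg_closed (mem (alg_center A)).
Proof.
split=> [|a u v|u v]; rewrite !inE.
- by move=> w; apply/commr_sym/commr1.
- move=> uC vC w; rewrite /GRing.comm mulrDl mulrDr -scalerAl -scalerAr.
  by rewrite uC vC.
- by move=> uC vC w; rewrite /GRing.comm -mulrA vC mulrA uC mulrA.
Qed.

Lemma subalg_closedXz (A : unitAlgType K) (B : set A) (u : A) (z : int) :
  GRing.subalg_closed (mem B) -> B u -> B u^-1 -> B (u ^ z).
Proof.
move=> [B1 _ BM] Bu BV.
have BX v (i : nat) : B v -> B (v ^+ i).
  move=> Bv; elim: i => [|i IH]; first by rewrite expr0 -in_setE.
  by rewrite exprS -in_setE; apply: BM; rewrite in_setE.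
by case: z => i; [apply: BX | rewrite NegzE -exprnN -exprVn; apply: BX].
Qed.

Variable m : nat.
Hypothesis n_odd : odd m.+1.
Local Notation n := m.+1.
Local Notation Z := (Zelt q_neq0 m).

Lemma Zelt_is_monomial : is_monomial q (@minor _ _ q_neq0 n n) (Zexp m) Z.
Proof.
apply: (is_monomialM q_neq0 (@minor_unit _ _ _ _ _) (@minor_qcomm _ _ _ _ _)).
all: apply: (is_monomial_prod q_neq0 (@minor_unit _ _ _ _ _)
  (@minor_qcomm _ _ _ _ _)) => i.
all: apply: (is_monomialX q_neq0 (@minor_unit _ _ _ _ _)
  (@minor_qcomm _ _ _ _ _)).
all: exact: is_monomial_gen.
Qed.

(** By [mul_Zexp_Lambda] the commutation exponents of [Z] with the generators are 0; induction
    extends this to the whole algebra. *)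
Lemma Zelt_central : alg_center (quasi_laurent q_neq0 n n) Z.
Proof.
have comm_minor s : GRing.comm Z (minor q_neq0 s).
  have [k ->] := Zelt_is_monomial; rewrite /GRing.comm -scalerAl -scalerAr.
  have := monomial_qcomm q_neq0 (@minor_unit _ _ q_neq0 n n)
    (@minor_qcomm _ _ q_neq0 n n) (Zexp m) s.
  by rewrite mul_Zexp_Lambda// mxE /qcomm expr0z scale1r => ->.
elim/quasi_laurentW => [s|s|||u v|u v|a u].
- exact: comm_minor.
- exact/commrV/comm_minor.
- exact: commr0.
- exact: commr1.
- exact: commrD.
- exact: commrM.
- by move=> Zu; rewrite /GRing.comm -scalerAl -scalerAr Zu.
Qed.

Hypothesis q_not_root : forall k : nat, (0 < k)%N -> ~~ k.-unity_root q.

Lemma center_quasi_laurent :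
  alg_center (quasi_laurent q_neq0 n n) = subalg_gen [set Z; Z^-1].
Proof.
apply/seteqP; split; last first.
  apply: smallest_sub; first exact: alg_center_subalg.
  move=> _ [->|->]; first exact: Zelt_central.
  by move=> u; apply/commr_sym/commrV/commr_sym/Zelt_central.
(* The generated subalgebra is an intersection, so [u] is placed in an arbitrary subalgebra [B]
   containing [Z] and its inverse. *)
move=> u uC B [B_alg BS]; have [B1 Blin _] := B_alg.
have [l [a [-> l0]]] := center_monomials q_neq0 (@minor_unit _ _ q_neq0 n n)
  (@minor_qcomm _ _ q_neq0 n n) q_not_root (@quasi_laurent_span _ _ q_neq0 n n)
  (@quasi_laurent_free _ _ q_neq0 n n) uC.
have B0 : (0 : quasi_laurent q_neq0 n n) \in mem B.
  by have := Blin (-1) _ _ B1 B1; rewrite scaleN1r addNr.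
rewrite -in_setE big_seq; elim/big_rec: _ => // v w vl Bw; apply: (Blin) => //.
have [k ->] := Lambda_kernel n_odd (l0 v vl).
have [j ZE] := is_monomialX q_neq0 (@minor_unit _ _ _ _ _)
  (@minor_qcomm _ _ _ _ _) k Zelt_is_monomial.
(* The summand 0 gives the form [a *: u + v] of the linear closure [Blin]. *)
have -> : monomial (minor q_neq0 (r := n)) (Zexp m *~ k) =
    q ^ (- j) *: Z ^ k + 0.
  by rewrite ZE scalerA -expfzDr// addNr expr0z scale1r addr0.
apply: Blin => //; rewrite in_setE.
by apply: subalg_closedXz => //; apply: BS; [left | right].
Qed.
End Center.

Local Open Scope complex_scope.
Local Open Scope classical_set_scope.

Theorem proposition5p2 (R : realType) (q : R[i]) (q_neq0 : q != 0)
    (q_not_root : forall k : nat, (0 < k)%N -> ~~ k.-unity_root q)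
    (m : nat) (n_odd : odd m.+1) :
  alg_center (quasi_laurent q_neq0 m.+1 m.+1) =
  subalg_gen [set Zelt q_neq0 m; (Zelt q_neq0 m)^-1].
Proof. exact: center_quasi_laurent. Qed.
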